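(* If $G$ is an unbalanced Theta graph, then $\mathrm{mdim}(G)=3$.
   Context: All graphs are finite, simple and connected. $d(a,b)$ denotes the usual shortest-path distance between vertices $a,b$, and for a vertex $a$ and an edge $e=bc$ one sets $d(a,e)=\min\{d(a,b),d(a,c)\}$. A vertex $s\in V(G)$ distinguishes two distinct elements $x,x'\in V(G)\cup E(G)$ if $d(s,x)\neq d(s,x')$. A set $S\subseteq V(G)$ is a mixed metric generator of $G$ if every pair of distinct elements $x,x'\in V(G)\cup E(G)$ is distinguished by at least one vertex of $S$. The mixed metric dimension $\mathrm{mdim}(G)$ is the cardinality of a smallest mixed metric generator of $G$. A Theta graph is a graph with two vertices $u$ and $v$ of degree $3$, all other vertices being of degree $2$, consisting of three pairwise internally vertex-disjoint paths connecting $u$ and $v$. The length of a path is its number of edges. A Theta graph is balanced if the lengths of the three paths connecting $u$ and $v$ pairwise differ by at most $1$; otherwise it is unbalanced. *)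

(* Defs.v *)
From mathcomp Require Import all_boot.

Set Implicit Arguments.
Unset Strict Implicit.
Unset Printing Implicit Defensive.

(* A finite simple graph is a symmetric irreflexive relation on a finType. *)

Definition connected_graph (T : finType) (e : rel T) : Prop :=
  forall x y : T, connect e x y.

Definition degree (T : finType) (e : rel T) (x : T) : nat :=
  #|[set y | e x y]|.

Definition edges (T : finType) (e : rel T) : {set {set T}} :=
  [set E | [exists x, exists y, e x y && (E == [set x; y])]].

Definition has_walk (T : finType) (e : rel T) (a b : T) (n : nat) : bool :=
  [exists p : n.-tuple T, path e a p && (last a p == b)].

(* Shortest-path distance: the least length of a walk from a to b. Lengths
   below #|T| suffice (dist_leq, dist_path); the value is #|T| when b is not
   reachable from a. *)
Definition dist (T : finType) (e : rel T) (a b : T) : nat :=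
  find (has_walk e a b) (iota 0 #|T|).

(* inl a is the vertex a; inr E, for E in edges e, is the edge E. *)
Definition element (T : finType) : finType := (T + {set T})%type.

Definition is_element (T : finType) (e : rel T) (x : element T) : bool :=
  match x with
  | inl _ => true
  | inr E => E \in edges e
  end.

(* The neutral element #|T| bounds every distance, so on an edge [set b; c]
   this is minn (dist e s b) (dist e s c); see dist_elt_edge. *)
Definition dist_elt (T : finType) (e : rel T) (s : T) (x : element T) : nat :=
  match x with
  | inl a => dist e s a
  | inr E => \big[minn/#|T|]_(b in E) dist e s b
  end.

Definition distinguishes (T : finType) (e : rel T) (s : T)
    (x x' : element T) : bool :=
  dist_elt e s x != dist_elt e s x'.

Definition mixed_metric_generator (T : finType) (e : rel T)
    (S : {set T}) : bool :=
  [forall x : element T, forall x' : element T,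
    [&& is_element e x, is_element e x' & x != x'] ==>
    [exists s in S, distinguishes e s x x']].

(* In a simple graph [set: T] is a mixed metric generator
   (mixed_metric_generatorT), so the minimum is attained; see mdimP. *)
Definition mdim (T : finType) (e : rel T) : nat :=
  #|[arg min_(S < [set: T] | mixed_metric_generator e S) #|S| ]|.

(* The i-th path is u :: p i, so its length (number of edges) is size (p i).
   [infix [:: x; y] s] says that x and y are consecutive in s. *)
Definition theta_paths (T : finType) (e : rel T) (u v : T)
    (p : 'I_3 -> seq T) : Prop :=
  [/\ forall i, [/\ path e u (p i), last u (p i) = v & uniq (u :: p i)],
      forall i j, i != j -> forall x,
        x \in u :: p i -> x \in u :: p j -> x = u \/ x = v,
      forall x, exists i, x \in u :: p i
    & forall x y, e x y -> exists i,
        infix [:: x; y] (u :: p i) || infix [:: y; x] (u :: p i)].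

Definition theta_decomposition (T : finType) (e : rel T) (u v : T)
    (p : 'I_3 -> seq T) : Prop :=
  [/\ u != v, degree e u = 3, degree e v = 3,
      forall x, x != u -> x != v -> degree e x = 2
    & theta_paths e u v p].

Definition theta_graph (T : finType) (e : rel T) : Prop :=
  exists (u v : T) (p : 'I_3 -> seq T), theta_decomposition e u v p.

Definition balanced_theta (T : finType) (e : rel T) : Prop :=
  exists (u v : T) (p : 'I_3 -> seq T),
    theta_decomposition e u v p /\
    forall i j, size (p i) <= (size (p j)).+1.

Definition unbalanced_theta (T : finType) (e : rel T) : Prop :=
  theta_graph e /\ ~ balanced_theta e.

Lemma distxx (T : finType) (e : rel T) (a : T) : dist e a a = 0.
Proof.
rewrite /dist; have : 0 < #|T| by apply/card_gt0P; exists a.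
case: #|T| => //= n _; case: ifP => // /existsP[].
by exists [tuple]; rewrite /= eqxx.
Qed.

Lemma dist_gt0 (T : finType) (e : rel T) (a b : T) : a != b -> 0 < dist e a b.
Proof.
move=> neq_ab; rewrite /dist; have : 0 < #|T| by apply/card_gt0P; exists a.
case: #|T| => //= n _; case: ifP => // /existsP[p].
by rewrite (tuple0 p) /= (negPf neq_ab).
Qed.

Lemma dist_leq_card (T : finType) (e : rel T) (a b : T) : dist e a b <= #|T|.
Proof. by have := find_size (has_walk e a b) (iota 0 #|T|); rewrite size_iota. Qed.

Lemma dist_leq (T : finType) (e : rel T) (a b : T) (p : seq T) :
  path e a p -> last a p = b -> dist e a b <= size p.
Proof.
move=> ep lp; have [lt_p|le_p] := ltnP (size p) #|T|; last first.
  exact: leq_trans (dist_leq_card e a b) le_p.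
rewrite leqNgt; apply/negP => lt_d.
have := before_find 0 lt_d; rewrite nth_iota // add0n => /existsP[].
by exists (in_tuple p); rewrite ep lp eqxx.
Qed.

Lemma dist_path (T : finType) (e : rel T) (a b : T) :
  connect e a b ->
  exists p, [/\ path e a p, last a p = b & size p = dist e a b].
Proof.
case/connectP => p0 ep0 ->; case/shortenP: ep0 => p ep up _.
have lt_p : size p < #|T|.
  by have := card_uniqP up => /= <-; apply: max_card.
have hp : has (has_walk e a (last a p)) (iota 0 #|T|).
  apply/hasP; exists (size p); first by rewrite mem_iota.
  by apply/existsP; exists (in_tuple p); rewrite ep eqxx.
have := nth_find 0 hp; rewrite nth_iota; last first.
  by move: hp; rewrite has_find size_iota.
rewrite add0n => /existsP[q /andP[eq /eqP lq]].
by exists q; split=> //; rewrite size_tuple.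
Qed.

Lemma dist_elt_edge (T : finType) (e : rel T) (s b c : T) :
  dist_elt e s (inr [set b; c]) = minn (dist e s b) (dist e s c).
Proof.
have le_big (A : {set T}) x : x \in A ->
    \big[minn/#|T|]_(y in A) dist e s y <= dist e s x.
  have [r <- [_ memr] _] := big_enumP (mem A).
  move=> xA; have {xA} : x \in r by rewrite memr.
  elim: r {memr} => // y r IHr.
  rewrite big_cons geq_min inE => /orP[/eqP-> | /IHr->]; last exact: orbT.
  by rewrite leqnn.
apply/eqP; rewrite /= eqn_leq leq_min !le_big ?set21 ?set22 //=.
elim/big_ind: _ => [|m n le_m le_n|x].
- by rewrite geq_min dist_leq_card.
- by rewrite leq_min le_m.
- by rewrite geq_min => /set2P[] ->; rewrite leqnn ?orbT.
Qed.

Lemma dist_elt_edge_eq0 (T : finType) (e : rel T) (s : T) (E : {set T}) :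
  E \in edges e -> (dist_elt e s (inr E) == 0) = (s \in E).
Proof.
have D0 x : (dist e s x == 0) = (s == x).
  have [->|/(dist_gt0 e)] := eqVneq s x; first by rewrite distxx.
  by case: (dist e s x).
rewrite /edges inE => /existsP[b /existsP[c /andP[_ /eqP->]]].
by rewrite dist_elt_edge !inE -!D0 -!leqn0 geq_min.
Qed.

Lemma mixed_metric_generatorT (T : finType) (e : rel T) :
  irreflexive e -> mixed_metric_generator e [set: T].
Proof.
move=> e_irr; have D0 (s a : T) : (dist_elt e s (inl a) == 0) = (s \in [set a]).
  rewrite inE /=; have [->|/(dist_gt0 e)] := eqVneq s a.
    by rewrite distxx.
  by case: (dist e s a).
pose supp (x : element T) := match x with inl a => [set a] | inr E => E end.
have suppE x s : is_element e x -> (dist_elt e s x == 0) = (s \in supp x).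
  by case: x => [a _ | E] /=; [exact: D0 | exact: dist_elt_edge_eq0].
have edge_n1 a : [set a] \notin edges e.
  rewrite /edges inE; apply/existsP => -[b /existsP[c /andP[ebc /eqP/setP Ea]]].
  have /set1P eb : b \in [set a] by rewrite Ea set21.
  have /set1P ec : c \in [set a] by rewrite Ea set22.
  by rewrite eb ec e_irr in ebc.
apply/forallP => x; apply/forallP => x'; apply/implyP => /and3P[xP x'P neq_x].
apply: contraT => /existsPn eq_d; case/negP: neq_x.
have eq_supp : supp x = supp x'.
  apply/setP => s; rewrite -!suppE //.
  by have := eq_d s; rewrite inE negbK => /eqP->.
case: x x' xP x'P eq_supp {eq_d} => [a|E] [a'|E'] /= xP x'P.
- by move/set1_inj->.
- by move=> E'E; rewrite -E'E (negPf (edge_n1 a)) in x'P.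
- by move=> EE; rewrite EE (negPf (edge_n1 a')) in xP.
- by move->.
Qed.

Lemma mdimP (T : finType) (e : rel T) : irreflexive e ->
  (exists2 S : {set T}, mixed_metric_generator e S & #|S| = mdim e) /\
  (forall S : {set T}, mixed_metric_generator e S -> mdim e <= #|S|).
Proof.
move=> e_irr; rewrite /mdim.
case: arg_minnP => [|S genS minS]; first exact: mixed_metric_generatorT.
by split; first by exists S.
Qed.

(* Main.v *)
Require Import Defs.
From mathcomp Require Import all_boot.
From mathcomp Require Import zify.

Set Implicit Arguments.
Unset Strict Implicit.
Unset Printing Implicit Defensive.

(** In any connected graph whose vertices all have degree at least 2, a mixed
    metric generator has at least three vertices ([card_generator_gt2]). What
    remains is a generator with three vertices.

    Let [A] be a shortest of the three paths, [C] a path at least two edges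
    longer, [B] the remaining one, and let [a <= b] and [c >= a + 2] be the
    lengths of [A], [B] and [C]. The generator consists of two vertices
    [near_u] and [near_v] of [C], at distance [h = (c - a) / 2] (rounded down)
    from [u] and from [v], and of a vertex in the middle of [B].

    The idea is that [near_u] and [near_v] do the work of [u] and [v] and more.
    Some geodesic from [near_u] to [v] passes through [u] and [A], because
    [h + a <= c - h], and likewise from [near_v] to [u]. Hence for every
    element outside [C], the distances from [near_u] and [near_v] are [h] plus
    the distances from [u] and [v]. The vertices [u], [v] and the midpoint of
    [B] cut the cycle formed by [A] and [B] into three arcs, none longer than
    half of the cycle, and three such vertices of a cycle tell its elements
    apart.

    As [h] is as large as possible, [near_u] and [near_v] reach the elements of
    [C] other than [u] and [v] directly along [C]. These two distances locate an element of [C],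
    except that beyond [near_u] or [near_v] they do not tell a vertex from one
    of its edges. The midpoint of [B], which sees that part of [C] from the
    other side, does. Finally, these elements of [C]
    cannot be confused with those of [A] and [B]: those beyond [near_u] or
    [near_v] are less than [h] away from it, and for those in between the sum
    of the two distances is at most [a + 1], whereas outside [C] it is at least
    [2 * h + a - 1]. As [0 < h], which is where the graph is unbalanced, only
    one tie is left, and it is broken by the midpoint of [B].

    The case distinctions behind this become linear arithmetic once distances
    are known in coordinates. The formula for them ([dist_pointE]) is proved
    by walks in one direction, and in the other by the fact that a function
    that changes by at most 1 along each edge changes by at most the distance
    between two vertices ([lipschitz_leq_dist]). The distances from the three
    vertices then form a code from which every element can be recovered
    ([is_element_code], [code_inj]). *)

(** * Distances in a connected graph *)

Section ConnectedGraph.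

Variables (T : finType) (e : rel T).
Hypotheses (e_sym : symmetric e) (e_irr : irreflexive e).
Hypothesis e_conn : connected_graph e.

Lemma dist_triangle x y z : dist e x z <= dist e x y + dist e y z.
Proof.
have [q [eq lq <-]] := dist_path (e_conn x y).
have [r [er lr <-]] := dist_path (e_conn y z).
rewrite -size_cat; apply: dist_leq; first by rewrite cat_path eq lq er.
by rewrite last_cat lq.
Qed.

Lemma dist_edge_leq1 x y : e x y -> dist e x y <= 1.
Proof. by move=> exy; apply: (@dist_leq _ _ _ _ [:: y]); rewrite //= exy. Qed.

Lemma edge_in_edges x y : e x y -> [set x; y] \in edges e.
Proof.
by move=> exy; rewrite inE; apply/existsP; exists x; apply/existsP; exists y;
   rewrite exy eqxx.
Qed.

Lemma generator_separates (S : {set T}) x x' :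
    mixed_metric_generator e S -> is_element e x -> is_element e x' ->
    x != x' ->
  exists2 s, s \in S & dist_elt e s x <> dist_elt e s x'.
Proof.
move=> /forallP/(_ x)/forallP/(_ x')/implyP genS ex ex' neq_x.
have /exists_inP[s sS /eqP dist_s] : [exists s in S, distinguishes e s x x'].
  by apply: genS; rewrite ex ex' neq_x.
by exists s.
Qed.

(** A vertex [x] and an edge [xy] are told apart only by vertices from which
    [y] is nearer than [x]. *)
Lemma generator_pulls (S : {set T}) x y :
    mixed_metric_generator e S -> e x y ->
  exists2 s, s \in S & dist e s y < dist e s x.
Proof.
move=> genS exy.
have [s sS] := @generator_separates S (inl x) (inr [set x; y]) genS isT
  (edge_in_edges exy) isT.
rewrite dist_elt_edge /= => d_s; exists s => //; lia.
Qed.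

(** If a generator [S] lay inside [[set s; t]] with [s] in [S], then, as [s]
    is at distance 0 from itself and from its edges, [t] alone would have to
    tell [s] from each edge at [s]. All neighbours of [s] would then be nearer
    to [t] than [s] is, by exactly one step, and two edges at [s] would have
    the same distances from both [s] and [t]. *)
Lemma card_generator_gt2 (S : {set T}) (x0 : T) :
    (forall x, 1 < degree e x) -> mixed_metric_generator e S -> 2 < #|S|.
Proof.
move=> deg_gt1 genS; rewrite ltnNge; apply/negP => S_le2.
have [s sS] : exists s, s \in S.
  have /card_gt0P[y] : 0 < degree e x0 by apply: ltnW.
  by rewrite inE => /(generator_pulls genS)[s]; exists s.
have /card_le1_eqP S_s : #|S :\ s| <= 1.
  by move: S_le2; rewrite (cardsD1 s) sS.
have /card_gt1P[y [z [+ + neq_yz]]] := deg_gt1 s.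
rewrite !inE => esy esz.
have pulls w : e s w -> exists2 t, t \in S :\ s & dist e t w < dist e t s.
  move=> /(generator_pulls genS)[t tS lt_t]; exists t => //.
  by rewrite !inE tS andbT; apply: contraTneq lt_t => ->; rewrite distxx ltn0.
have [t tS lt_y] := pulls y esy; have [t' t'S lt_z] := pulls z esz.
have {}lt_z : dist e t z < dist e t s by rewrite (S_s t' t).
have neq_E : inr [set s; y] != inr [set s; z] :> element T.
  apply: contraNneq neq_yz => -[/setP/(_ y)]; rewrite !inE eqxx orbT.
  by case: eqVneq esy => [->|_ _ /=]; rewrite ?e_irr.
have [r rS] := generator_separates genS (x := inr _) (x' := inr _)
  (edge_in_edges esy) (edge_in_edges esz) neq_E.
rewrite !dist_elt_edge; have [->|neq_rs] := eqVneq r s.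
  by rewrite distxx !min0n.
have -> : r = t by apply: S_s; rewrite // !inE neq_rs.
have := dist_triangle t y s; have := dist_triangle t z s.
have := dist_edge_leq1 (etrans (e_sym y s) esy).
have := dist_edge_leq1 (etrans (e_sym z s) esz).
lia.
Qed.

End ConnectedGraph.

(** * Coordinates on a Theta graph *)

Section ThetaGraph.

Variables (T : finType) (e : rel T) (u v : T) (p : 'I_3 -> seq T).
Hypotheses (e_sym : symmetric e) (e_conn : connected_graph e).
Hypothesis thetaP : theta_paths e u v p.

Definition point i k := nth u (u :: p i) k.

Local Notation L i := (size (p i)).

Lemma point_last i : point i (L i) = v.
Proof.
have [/(_ i)[_ <- _] _ _ _] := thetaP.
by rewrite /point -[RHS]/(last u (u :: p i)) -nth_last.
Qed.

Lemma point_inj i k m : k <= L i -> m <= L i -> point i k = point i m -> k = m.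
Proof.
have [/(_ i)[_ _ uniq_p] _ _ _] := thetaP => le_k le_m /eqP.
by rewrite nth_uniq // => /eqP.
Qed.

Lemma point_eq_ends i j k m : i != j -> k <= L i -> m <= L j ->
    point i k = point j m ->
  (k = 0 /\ m = 0) \/ (k = L i /\ m = L j).
Proof.
move=> neq_ij le_k le_m eq_km; have [_ disj _ _] := thetaP.
have [||eq_u|eq_v] := disj i j neq_ij (point i k).
- exact: mem_nth.
- by rewrite eq_km; apply: mem_nth.
- by left; split; [apply: (@point_inj i) | apply: (@point_inj j)];
     rewrite -?eq_km ?eq_u.
- by right; split; [apply: (@point_inj i) | apply: (@point_inj j)];
     rewrite -?eq_km ?eq_v ?point_last.
Qed.

Lemma point_edge i k : k < L i -> e (point i k) (point i k.+1).
Proof. by have [/(_ i)[/(pathP u) + _ _] _ _ _] := thetaP => /(_ k). Qed.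

Lemma vertex_point x : exists i k, k <= L i /\ x = point i k.
Proof.
have [_ _ /(_ x)[i xi] _] := thetaP.
exists i, (index x (u :: p i)); split; first by rewrite -ltnS -index_mem in xi *.
by rewrite /point nth_index.
Qed.

Lemma edge_point x y : e x y -> exists i k, k < L i /\
  ((x = point i k /\ y = point i k.+1) \/ (y = point i k /\ x = point i k.+1)).
Proof.
have consecutive i a b : infix [:: a; b] (u :: p i) ->
    exists2 k, k < L i & a = point i k /\ b = point i k.+1.
  case/infixP => r [r' def_p]; exists (size r).
    by rewrite -ltnS -[(L i).+1]/(size (u :: p i)) def_p !size_cat /=; lia.
  rewrite /point def_p !nth_cat ltnn subnn /= ltnNge leqnSn /=.
  by rewrite subSn // subnn.
have [_ _ _ infix_e] := thetaP => /infix_e[i].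
by case/orP=> /consecutive[k lt_k eq_k]; exists i, k; split=> //; [left | right].
Qed.

Lemma dist_point_leq i k m : k <= L i -> m <= L i ->
  dist e (point i k) (point i m) <= (k - m) + (m - k).
Proof.
have up n : forall k, k + n <= L i ->
    dist e (point i k) (point i (k + n)) <= n /\
    dist e (point i (k + n)) (point i k) <= n.
  elim: n => [|n IHn] l le_l; first by rewrite addn0 distxx.
  rewrite addnS in le_l *; have [IH1 IH2] := IHn l (ltnW le_l).
  have edge := point_edge le_l; have edge' := etrans (e_sym _ _) edge.
  have := dist_edge_leq1 edge; have := dist_edge_leq1 edge'.
  have := dist_triangle e_conn (point i l) (point i (l + n)) (point i (l + n).+1).
  have := dist_triangle e_conn (point i (l + n).+1) (point i (l + n)) (point i l).
  lia.
move=> le_k le_m; have [le_km|/ltnW le_mk] := leqP k m.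
  by have [] := up (m - k) k; rewrite subnKC // (eqP le_km).
by have [] := up (k - m) m; rewrite subnKC // (eqP le_mk) addn0.
Qed.

(** A labelling of the vertices by numbers that changes by at most 1 along
    each edge changes by at most the distance between two vertices. A
    labelling is given in coordinates, so it must agree at the common
    endpoints of the paths. *)
Lemma lipschitz_leq_dist (f : 'I_3 -> nat -> nat) :
    (forall i k, k < L i -> f i k <= (f i k.+1).+1 /\ f i k.+1 <= (f i k).+1) ->
    (forall i j, f i 0 = f j 0) ->
    (forall i j, f i (L i) = f j (L j)) ->
  forall i j k m, k <= L i -> m <= L j ->
    f j m <= f i k + dist e (point i k) (point j m).
Proof.
move=> lip f_u f_v i j k m le_k le_m.
have f_point i1 j1 k1 m1 : k1 <= L i1 -> m1 <= L j1 ->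
    point i1 k1 = point j1 m1 -> f i1 k1 = f j1 m1.
  have [<-|neq_ij] := eqVneq i1 j1.
    by move=> le_k1 le_m1 /(point_inj le_k1 le_m1)->.
  move=> le_k1 le_m1 /(point_eq_ends neq_ij le_k1 le_m1).
  by case=> -[-> ->]; [apply: f_u | apply: f_v].
have [q [eq lq <-]] := dist_path (e_conn (point i k) (point j m)).
elim: q i k le_k eq lq => [|y q IHq] i k le_k /=.
  by move=> _ /f_point->; rewrite ?addn0.
case/andP=> /edge_point[i1 [k1 [lt_k1 exy]]] eq lq.
have [lip1 lip2] := lip i1 k1 lt_k1; have le_k1 := ltnW lt_k1.
case: exy => [] [].
  move=> eq_x eq_y; rewrite eq_y in eq lq; have := IHq i1 _ lt_k1 eq lq.
  by have := f_point _ _ _ _ le_k le_k1 eq_x; lia.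
move=> eq_y eq_x; rewrite eq_y in eq lq; have := IHq i1 _ le_k1 eq lq.
by have := f_point _ _ _ _ le_k lt_k1 eq_x; lia.
Qed.

(** [elt i k false] is the [k]-th vertex of path [i] and [elt i k true] the
    edge that follows it. With [b : bool] read as 0 or 1, both are the segment
    from position [k] to position [k + b], so one formula gives the distances
    of both. *)
Definition elt i k (b : bool) : element T :=
  if b then inr [set point i k; point i k.+1] else inl (point i k).

Lemma dist_elt_elt s i k b :
  dist_elt e s (elt i k b) =
    minn (dist e s (point i k)) (dist e s (point i (k + b))).
Proof.
by case: b; rewrite /elt ?dist_elt_edge ?addn1 // addn0 minnn.
Qed.

Lemma is_element_elt x : is_element e x ->
  exists i k (b : bool), k + b <= L i /\ x = elt i k b.
Proof.
case: x => [x _|E].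
  have [i [k [le_k ->]]] := vertex_point x.
  by exists i, k, false; rewrite addn0.
rewrite /= inE => /existsP[x /existsP[y /andP[/edge_point + /eqP->]]].
case=> i [k [lt_k [] [-> ->]]]; exists i, k, true; rewrite addn1 /elt //.
by rewrite setUC.
Qed.

Section Distances.

Variable A : 'I_3.
Hypothesis A_min : forall i, L A <= L i.

Section FromPoint.

Variables (i0 : 'I_3) (k0 du dv : nat).
Hypothesis k0_le : k0 <= L i0.
Hypothesis duE : du = minn k0 (L A + (L i0 - k0)).
Hypothesis dvE : dv = minn (L i0 - k0) (L A + k0).

(** Here [du] and [dv] are the distances from [point i0 k0] to [u] and [v]: a
    geodesic between [u] and [v] is the shortest path [A]. Other vertices are
    reached through [u] or through [v], or directly inside path [i0]. *)
Lemma dist_pointE i k : k <= L i ->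
  dist e (point i0 k0) (point i k) =
    if i == i0 then minn ((k0 - k) + (k - k0)) (minn (du + k) (dv + (L i - k)))
    else minn (du + k) (dv + (L i - k)).
Proof.
move=> le_k; apply/eqP; rewrite eqn_leq; apply/andP; split.
  have to_u : dist e (point i0 k0) u <= du.
    have := dist_point_leq k0_le (leq0n _).
    have := dist_point_leq k0_le (leqnn _).
    have := dist_point_leq (i := A) (leqnn _) (leq0n _).
    have := dist_triangle e_conn (point i0 k0) v u.
    rewrite !point_last -[point i0 0]/u -[point A 0]/u; lia.
  have to_v : dist e (point i0 k0) v <= dv.
    have := dist_point_leq k0_le (leq0n _).
    have := dist_point_leq k0_le (leqnn _).
    have := dist_point_leq (i := A) (leq0n _) (leqnn _).
    have := dist_triangle e_conn (point i0 k0) u v.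
    rewrite !point_last -[point i0 0]/u -[point A 0]/u; lia.
  have via_u : dist e (point i0 k0) (point i k) <= du + k.
    have := dist_point_leq (leq0n _) le_k.
    have := dist_triangle e_conn (point i0 k0) u (point i k).
    rewrite -[point i 0]/u; lia.
  have via_v : dist e (point i0 k0) (point i k) <= dv + (L i - k).
    have := dist_point_leq (leqnn _) le_k.
    have := dist_triangle e_conn (point i0 k0) v (point i k).
    rewrite point_last; lia.
  case: eqP => [eq_i|_]; rewrite ?leq_min ?via_u ?via_v ?andbT //.
  by subst i; apply: dist_point_leq.
pose f i1 k1 :=
  if i1 == i0 then
    minn ((k0 - k1) + (k1 - k0)) (minn (du + k1) (dv + (L i1 - k1)))
  else minn (du + k1) (dv + (L i1 - k1)).
have f_u i1 : f i1 0 = du.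
  have := A_min i1; have := A_min i0; rewrite /f.
  by case: eqP => [->|_]; lia.
have f_v i1 : f i1 (L i1) = dv.
  have := A_min i1; have := A_min i0; rewrite /f.
  by case: eqP => [->|_]; lia.
have f_0 : f i0 k0 = 0 by rewrite /f eqxx subnn min0n.
rewrite -[X in X <= _]/(f i k) -[dist e _ _]add0n -[X in X + _]f_0.
apply: lipschitz_leq_dist => // [i1 k1 lt_k1|i1 i2|i1 i2].
- by rewrite /f; case: ifP => _; lia.
- by rewrite !f_u.
- by rewrite !f_v.
Qed.

Lemma dist_elt_other i k (b : bool) : i != i0 -> k + b <= L i ->
  dist_elt e (point i0 k0) (elt i k b) =
    minn (du + k) (dv + (L i - (k + b))).
Proof.
move=> /negPf neq_i le_kb; have le_k : k <= L i by lia.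
rewrite dist_elt_elt !dist_pointE // neq_i minnACA.
by congr minn; [apply/minn_idPl | apply/minn_idPr]; lia.
Qed.

Lemma dist_elt_own k (b : bool) : k + b <= L i0 ->
  dist_elt e (point i0 k0) (elt i0 k b) =
    minn ((k0 - (k + b)) + (k - k0)) (minn (du + k) (dv + (L i0 - (k + b)))).
Proof.
move=> le_kb; have le_k : k <= L i0 by lia.
rewrite dist_elt_elt !dist_pointE // eqxx minnACA (minnACA (du + k)).
congr (minn _ (minn _ _)); first by clear; case: b; lia.
  by apply/minn_idPl; lia.
by apply/minn_idPr; lia.
Qed.

End FromPoint.
End Distances.

(** Every neighbour of [u] begins one of the three paths, so three neighbours
    require three different first steps. In particular at most one of the paths
    is a single edge. *)
Lemma first_step_inj : degree e u = 3 -> injective (fun i => point i 1).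
Proof.
move=> deg_u; pose step := [set point i 1 | i : 'I_3].
have sub_step : [set y | e u y] \subset step.
  apply/subsetP => y; rewrite inE => /edge_point[i [k [lt_k [] [eq_u eq_y]]]].
    have k0 : k = 0 by apply/esym/(@point_inj i); rewrite // ltnW.
    by apply/imsetP; exists i => //; rewrite eq_y k0.
  by have := @point_inj i 0 k.+1 (leq0n _) lt_k eq_y.
have card_step : #|step| == #|'I_3|.
  by rewrite eqn_leq leq_imset_card card_ord -deg_u subset_leq_card.
by move=> i j eq_ij; have /imset_injP := card_step; apply.
Qed.

(** * The generator of an unbalanced Theta graph *)

Section Generator.

Hypothesis neq_uv : u != v.

Lemma path_length_gt0 i : 0 < L i.
Proof.
rewrite lt0n; apply: contra neq_uv => /eqP Li0.
by rewrite -(point_last i) Li0.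
Qed.

(** The paths play the roles of a shortest path ([A]), a path at least two
    edges longer ([C]) and the remaining path ([B]). *)
Variables A B C : 'I_3.
Hypotheses (neq_AB : A != B) (neq_AC : A != C) (neq_BC : B != C).
Hypothesis coverABC : forall i, [\/ i = A, i = B | i = C].
Hypothesis A_min : forall i, L A <= L i.
Hypothesis gapAC : L A + 2 <= L C.
Hypothesis B_gt1 : 1 < L B.

Let h := (L C - L A)./2.
Let j := (L B)./2.

(* Both [near_u]-to-[v] via [u], of length [h + L A], and the direct way along
   [C], of length [L C - h], matter below: these bounds say that the former is
   at most the latter, and shorter by at most 1. *)
Let h_gt0 : 0 < h. Proof. by rewrite /h; lia. Qed.
Let le_h : 2 * h <= L C - L A. Proof. by rewrite /h; lia. Qed.
Let ge_h : L C - L A <= 2 * h + 1. Proof. by rewrite /h; lia. Qed.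
Let le_j : 2 * j <= L B. Proof. by rewrite /j; lia. Qed.
Let ge_j : L B <= 2 * j + 1. Proof. by rewrite /j; lia. Qed.

Definition near_u := point C h.
Definition near_v := point C (L C - h).
Definition midpoint := point B j.

(** The relations [codeA], [codeB] and [codeC] describe, for the segment from
    position [k] to position [k + b] of each path, its distances [ds], [dt] and
    [dw] from [near_u], [near_v] and [midpoint]. On [B] the alternatives are
    that [v] is reached through [u], that [u] and [v] are both reached
    directly, and that [u] is reached through [v]. On [C] they are the parts
    between [u] and [near_u], between [near_u] and [near_v], and between
    [near_v] and [v]. The endpoints [u] and [v] count as points of [A] only,
    so that each element has a single place. *)
Definition codeA k (b : bool) ds dt dw :=
  [/\ k + b <= L A, ds = h + k, dt + k + b = h + L A
    & dw = minn (j + k) (L B - j + (L A - (k + b)))].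

Definition codeB k (b : bool) ds dt dw :=
  [/\ 0 < k + b, k < L B, k + b <= L B &
  [\/ [/\ L A + 2 * k + b <= L B, ds = h + k, dt = h + L A + k
        & dw + k + b = j],
      [/\ ds = h + k, dt + k + b = h + L B
        & dw = maxn (j - (k + b)) (k - j)]
    | [/\ L A + L B <= 2 * k + b, ds + k + b = h + L A + L B,
          dt + k + b = h + L B & dw + j = k]]].

Definition codeC k (b : bool) ds dt dw :=
  [/\ 0 < k + b, k < L C, k + b <= L C &
  [\/ [/\ k + b <= h, ds + k + b = h, dt + h + k + b = L C & dw = j + k],
      [/\ h <= k, k + b <= L C - h, ds + h = k /\ dt + h + k + b = L C
        & dw = minn (j + k) (L B - j + (L C - (k + b)))]
    | [/\ L C - h <= k, ds + h = k, dt + L C = h + k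
        & dw + j + k + b = L B + L C]]].

Definition code i k b ds dt dw :=
  [\/ i = A /\ codeA k b ds dt dw, i = B /\ codeB k b ds dt dw
    | i = C /\ codeC k b ds dt dw].

Lemma dist_near_u i k (b : bool) : k + b <= L i ->
  dist_elt e near_u (elt i k b) =
    if i == C then minn (maxn (h - (k + b)) (k - h))
                        (h + L A + (L C - (k + b)))
    else h + minn k (L A + (L i - (k + b))).
Proof.
move=> le_kb.
have du : h = minn h (L A + (L C - h)) by lia.
have dv : h + L A = minn (L C - h) (L A + h) by lia.
have le_hC : h <= L C by lia.
case: eqVneq le_kb => [->|neq_i] le_kb.
  rewrite (dist_elt_own A_min le_hC du dv le_kb).
  clear du dv; lia.
rewrite (dist_elt_other A_min le_hC du dv neq_i le_kb).
clear du dv; lia.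
Qed.

Lemma dist_near_v i k (b : bool) : k + b <= L i ->
  dist_elt e near_v (elt i k b) =
    if i == C then minn (maxn (L C - h - (k + b)) (k - (L C - h)))
                        (h + L A + k)
    else h + minn (L A + k) (L i - (k + b)).
Proof.
move=> le_kb.
have du : h + L A = minn (L C - h) (L A + (L C - (L C - h))) by lia.
have dv : h = minn (L C - (L C - h)) (L A + (L C - h)) by lia.
have le_hC : L C - h <= L C by lia.
case: eqVneq le_kb => [->|neq_i] le_kb.
  rewrite (dist_elt_own A_min le_hC du dv le_kb).
  clear du dv; lia.
rewrite (dist_elt_other A_min le_hC du dv neq_i le_kb).
clear du dv; lia.
Qed.

Lemma dist_midpoint i k (b : bool) : k + b <= L i ->
  dist_elt e midpoint (elt i k b) =
    if i == B then maxn (j - (k + b)) (k - j)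
    else minn (j + k) (L B - j + (L i - (k + b))).
Proof.
move=> le_kb.
have LA_gt0 := path_length_gt0 A.
have du : j = minn j (L A + (L B - j)) by lia.
have dv : L B - j = minn (L B - j) (L A + j) by lia.
have le_jB : j <= L B by lia.
case: eqVneq le_kb => [->|neq_i] le_kb.
  rewrite (dist_elt_own A_min le_jB du dv le_kb).
  clear du dv; lia.
by rewrite (dist_elt_other A_min le_jB du dv neq_i le_kb).
Qed.

Lemma elt_end_u i : elt i 0 false = elt A 0 false.
Proof. by []. Qed.

Lemma elt_end_v i : elt i (L i) false = elt A (L A) false.
Proof. by rewrite /elt !point_last. Qed.

Lemma is_element_code x : is_element e x -> exists i k b, x = elt i k b /\
  code i k b (dist_elt e near_u x) (dist_elt e near_v x)
             (dist_elt e midpoint x).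
Proof.
have onA k (b : bool) : k + b <= L A -> exists i' k' b', elt A k b = elt i' k' b' /\
    code i' k' b' (dist_elt e near_u (elt A k b))
      (dist_elt e near_v (elt A k b)) (dist_elt e midpoint (elt A k b)).
  move=> le_kb; exists A, k, b; split=> //; apply: Or31; split=> //.
  have := A_min B.
  rewrite dist_near_u // dist_near_v // dist_midpoint //.
  rewrite (negPf neq_AB) (negPf neq_AC) => le_AB.
  split; lia.
case/is_element_elt=> i [k [b [le_kb ->]]].
have [kb0|kb_gt0] := posnP (k + b).
  have [-> ->] : k = 0 /\ b = false by case: b kb0 {le_kb} => //=; lia.
  by rewrite elt_end_u; apply: onA.
have [lt_k|ge_k] := ltnP k (L i); last first.
  have [-> ->] : k = L i /\ b = false by case: b le_kb {kb_gt0} => //=; lia.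
  by rewrite elt_end_v; apply: onA; rewrite addn0.
have [eq_i|eq_i|eq_i] := coverABC i; subst i.
- exact: onA.
- exists B, k, b; split=> //; apply: Or32; split=> //; split=> //.
  rewrite dist_near_u // dist_near_v // dist_midpoint // eqxx (negPf neq_BC).
  have := A_min B; have := path_length_gt0 A => LA_gt0 le_AB.
  have [near|far] := leqP (L A + 2 * k + b) (L B).
    by apply: Or31; split; lia.
  have [near|mid] := leqP (L A + L B) (2 * k + b).
    by apply: Or33; split; lia.
  by apply: Or32; split; lia.
- exists C, k, b; split=> //; apply: Or33; split=> //; split=> //.
  rewrite dist_near_u // dist_near_v // dist_midpoint // eqxx.
  rewrite [C == B]eq_sym (negPf neq_BC).
  have := A_min B; have := path_length_gt0 A => LA_gt0 le_AB.
  have [near|far] := leqP (k + b) h.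
    by apply: Or31; split; lia.
  have [near|mid] := leqP (L C - h) k.
    by apply: Or33; split; lia.
  by apply: Or32; split; [lia | lia | split; lia | lia].
Qed.

(** Along [A], going away from [u], [ds] gives the start of a segment and [dt]
    its end. *)
Lemma codeA_inj k k' b b' ds dt dw :
  codeA k b ds dt dw -> codeA k' b' ds dt dw -> k = k' /\ b = b'.
Proof. by move=> [? ? ? _] [? ? ? _]; lia. Qed.

(** Where [v] is reached through [u], both [ds] and [dt] give only the end of
    the segment nearer to [u]; the other end is given by [dw], as [midpoint]
    lies on the other side. The situation at [v] is symmetric. *)
Lemma codeB_inj k k' b b' ds dt dw :
  codeB k b ds dt dw -> codeB k' b' ds dt dw -> k = k' /\ b = b'.
Proof.
have LA_gt0 := path_length_gt0 A.
by move=> [? ? ? [[? ? ? ?]|[? ? ?]|[? ? ? ?]]]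
          [? ? ? [[? ? ? ?]|[? ? ?]|[? ? ? ?]]]; lia.
Qed.

(** Between [near_u] and [near_v], [ds] and [dt] give the two ends of the
    segment. On the outer parts they give the same end, and [midpoint], which
    is reached through [u] or [v], gives the other. *)
Lemma codeC_inj k k' b b' ds dt dw :
  codeC k b ds dt dw -> codeC k' b' ds dt dw -> k = k' /\ b = b'.
Proof.
have LA_gt0 := path_length_gt0 A.
by move=> [? ? ? [[? ? ? ?]|[? ? [? ?] ?]|[? ? ? ?]]]
          [? ? ? [[? ? ? ?]|[? ? [? ?] ?]|[? ? ? ?]]]; lia.
Qed.

(** An element of [A] and one of [B] have the same distances from [u] and from
    [v] only if they are [u] or [v] and the edge of [B] there, or if [B] is at
    most one edge longer than [A]. In all cases the element of [B] is closer to
    [midpoint], which the element of [A] reaches only through [u] or [v]. *)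
Lemma codeAB_disjoint k k' b b' ds dt dw :
  codeA k b ds dt dw -> codeB k' b' ds dt dw -> False.
Proof.
have LA_gt0 := path_length_gt0 A; have le_AB := A_min B.
by move=> [? ? ? ?] [? ? ? [[? ? ? ?]|[? ? ?]|[? ? ? ?]]]; lia.
Qed.

(** On [A] both [ds] and [dt] are at least [h], so only the part of [C] between
    [near_u] and [near_v] matters. There [ds + dt] is at most [L A + 1], and on
    [A] it is at least [2 * h + L A - 1]. Equality forces [h = 1], an edge of
    [A] and a vertex of [C]; the edge of [A] is then closer to [midpoint]. *)
Lemma codeAC_disjoint k k' b b' ds dt dw :
  codeA k b ds dt dw -> codeC k' b' ds dt dw -> False.
Proof.
have LA_gt0 := path_length_gt0 A; have le_AB := A_min B.
by move=> [? ? ? ?] [? ? ? [[? ? ? ?]|[? ? [? ?] ?]|[? ? ? ?]]]; lia.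
Qed.

(** The bounds on [ds] and [dt] used for [A] hold on [B] too, and the only tie
    is again with an edge of [B], which is closer to [midpoint]. *)
Lemma codeBC_disjoint k k' b b' ds dt dw :
  codeB k b ds dt dw -> codeC k' b' ds dt dw -> False.
Proof.
have LA_gt0 := path_length_gt0 A; have le_AB := A_min B.
by move=> [? ? ? [[? ? ? ?]|[? ? ?]|[? ? ? ?]]]
          [? ? ? [[? ? ? ?]|[? ? [? ?] ?]|[? ? ? ?]]]; lia.
Qed.

Lemma code_inj i i' k k' b b' ds dt dw :
    code i k b ds dt dw -> code i' k' b' ds dt dw ->
  elt i k b = elt i' k' b'.
Proof.
case=> -[-> code1] [] [-> code2].
- by have [-> ->] := codeA_inj code1 code2.
- by case: (codeAB_disjoint code1 code2).
- by case: (codeAC_disjoint code1 code2).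
- by case: (codeAB_disjoint code2 code1).
- by have [-> ->] := codeB_inj code1 code2.
- by case: (codeBC_disjoint code1 code2).
- by case: (codeAC_disjoint code2 code1).
- by case: (codeBC_disjoint code2 code1).
- by have [-> ->] := codeC_inj code1 code2.
Qed.

Lemma unbalanced_generator :
  mixed_metric_generator e [set near_u; near_v; midpoint].
Proof.
apply/forallP => x; apply/forallP => x'; apply/implyP => /and3P[ex ex' neq_x].
apply: contraT => /exists_inPn same; case/negP: neq_x.
have eq_d s : s \in [set near_u; near_v; midpoint] ->
    dist_elt e s x = dist_elt e s x'.
  by move=> /same; rewrite negbK => /eqP.
have [i [k [b [x_elt code_x]]]] := is_element_code ex.
have [i' [k' [b' [x'_elt code_x']]]] := is_element_code ex'.
rewrite !eq_d ?inE ?eqxx ?orbT // in code_x.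
by rewrite x_elt x'_elt; apply/eqP/(code_inj code_x code_x').
Qed.

End Generator.
End ThetaGraph.

Theorem theorem10 (T : finType) (e : rel T) (e_sym : symmetric e)
    (e_irr : irreflexive e) (e_conn : connected_graph e)
    (e_theta : unbalanced_theta e) :
  mdim e = 3.
Proof.
case: e_theta => -[u [v [p decomp]]] unbalanced.
have [neq_uv deg_u deg_v deg2 thetaP] := decomp.
have [[S genS <-] mdim_min] := mdimP e_irr.
apply/eqP; rewrite eqn_leq; apply/andP; split; last first.
  apply: (card_generator_gt2 e_sym e_irr e_conn u) genS => x.
  have [->|neq_xu] := eqVneq x u; first by rewrite deg_u.
  have [->|neq_xv] := eqVneq x v; first by rewrite deg_v.
  by rewrite deg2.
have [j [C gap]] : exists j C, (size (p j)).+1 < size (p C).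
  apply/'exists_existsP; apply: contraT => /existsPn no_gap.
  case: unbalanced; exists u, v, p; split=> // i j; rewrite leqNgt.
  by have /existsPn/(_ i) := no_gap j.
pose A := [arg min_(i < j) size (p i)].
have A_min i : size (p A) <= size (p i).
  by rewrite /A; case: arg_minnP => // i0 _; apply.
have gapAC : size (p A) + 2 <= size (p C) by have := A_min j; lia.
have neq_AC : A != C by apply: contraTneq gapAC => ->; lia.
have [B] : exists B, B \notin [set A; C].
  apply/existsP; rewrite -negb_forall; apply/negP => /forallP all_AC.
  have : #|'I_3| <= #|[set A; C]| by apply/subset_leq_card/subsetP => i _.
  by rewrite card_ord cards2 neq_AC.
rewrite !inE negb_or => /andP[neq_BA neq_BC].
have cover i : [\/ i = A, i = B | i = C].
  have : i \in [set A; B; C].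
    suff -> : [set A; B; C] = setT by rewrite inE.
    apply/eqP; rewrite eqEcard subsetT cardsT card_ord /=.
    by rewrite setUC cardsU1 cards2 !inE negb_or [C == _]eq_sym neq_AC
               [C == _]eq_sym neq_BC [A == B]eq_sym neq_BA.
  by rewrite !inE => /orP[/orP[]|] /eqP; [apply: Or31 | apply: Or32 | apply: Or33].
have B_gt1 : 1 < size (p B).
  rewrite ltnNge; apply: contra neq_BA => B_le1; apply/eqP.
  have := path_length_gt0 thetaP neq_uv A; have := A_min B => le_AB A_gt0.
  have A1 : size (p A) = 1 by lia.
  have B1 : size (p B) = 1 by lia.
  apply: (first_step_inj thetaP deg_u) => /=.
  by rewrite -{1}B1 -A1 !(point_last thetaP).
have neq_AB : A != B by rewrite eq_sym.
have gen3 := unbalanced_generator e_sym e_conn thetaP neq_uv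
  neq_AB neq_AC neq_BC cover A_min gapAC B_gt1.
apply: leq_trans (mdim_min _ gen3) _.
by rewrite setUC cardsU1 cards2; case: (_ \notin _); case: (_ != _).
Qed.
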